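(* If $n\ge 1$ and $P\in\mathcal{H}_n$, then $P\preccurlyeq T(P)$ for any $T\in\mathcal{A}'$.
   Context: $\mathbb{C}[x]$ is the complex vector space of polynomials. For $n\ge1$, $\mathcal{H}_n$ is the set of monic polynomials of degree $n$ with only real zeros; $\mathcal{H}_0=\{1\}$. For $n\ge 0$, $\mathcal{A}_n(\mathbb{R})$ is the set of linear maps $T:\mathbb{C}[x]\to\mathbb{C}[x]$ with $T(\mathcal{H}_n)\subseteq\mathcal{H}_n$. Set $\mathcal{A}=\bigcap_{n=0}^\infty\mathcal{A}_n(\mathbb{R})$. For a non-constant $P\in\mathbb{C}[x]$ let $\sigma(P)$ be the sum of its zeros (with multiplicity), and set $\mathcal{A}'=\{T\in\mathcal{A}\mid\sigma(T(P))=\sigma(P)\text{ for all }P\in\mathbb{C}[x]\text{ with }\deg P\ge1\}$. $\mathcal{Z}(P)$ is the unordered $n$-tuple of zeros of $P$ counted with multiplicity. For real $n$-tuples, $X\prec Y$ means $\sum_i f(x_i)\le\sum_i f(y_i)$ for every convex $f:\mathbb{R}\to\mathbb{R}$ (equivalently $X=AY$ for some doubly stochastic matrix $A$). For $P,Q\in\mathcal{H}_n$, $P\preccurlyeq Q$ means $\mathcal{Z}(P)\prec\mathcal{Z}(Q)$. *)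

(* Defs.v *)
(* MathComp / MathComp-Analysis, with R[i] from MathComp-Real-Closed. *)
From mathcomp Require Import all_boot all_order all_algebra.
From mathcomp Require Import complex.
From mathcomp Require Import classical_sets reals convex.

Set Implicit Arguments.
Unset Strict Implicit.
Unset Printing Implicit Defensive.

Import Order.TTheory GRing.Theory Num.Theory.

Local Open Scope ring_scope.
Local Open Scope classical_set_scope.

(* For n = 0 this is {1}: see hyperbolic0. *)
Definition hyperbolic (R : realType) (n : nat) : set {poly R[i]} :=
  [set P | [/\ P \is monic, size P = n.+1 &
             forall z : R[i], root P z -> z \is Num.real]].
Arguments hyperbolic R n : clear implicits.

(* An arbitrary listing of the zeros with multiplicity (see zerosE); everything
   below depends on it only up to permutation. The list is junk for P = 0. *)
Definition zeros (R : realType) (P : {poly R[i]}) : seq R[i] :=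
  sval (closed_field_poly_normal P).

Definition sum_zeros (R : realType) (P : {poly R[i]}) : R[i] :=
  \sum_(z <- zeros P) z.

Definition preserver (R : realType) (n : nat) :
    set {linear {poly R[i]} -> {poly R[i]}} :=
  [set T | T @` hyperbolic R n `<=` hyperbolic R n].
Arguments preserver R n : clear implicits.

Definition preservers (R : realType) :
    set {linear {poly R[i]} -> {poly R[i]}} :=
  \bigcap_n preserver R n.
Arguments preservers R : clear implicits.

Definition sum_preservers (R : realType) :
    set {linear {poly R[i]} -> {poly R[i]}} :=
  [set T | preservers R T /\
    forall P : {poly R[i]}, (1 < size P)%N -> sum_zeros (T P) = sum_zeros P].
Arguments sum_preservers R : clear implicits.

Definition majorized (R : realType) (X Y : seq R) : Prop :=
  size X = size Y /\
  forall f : R -> R, convex_function [set: R^o] f ->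
    \sum_(x <- X) f x <= \sum_(y <- Y) f y.

(* The zeros of hyperbolic polynomials being real, taking real parts only
   transports them from R[i] to R. *)
Definition zeros_majorized (R : realType) (n : nat) (P Q : {poly R[i]}) : Prop :=
  [/\ hyperbolic R n P, hyperbolic R n Q &
      majorized (map (@complex.Re R) (zeros P)) (map (@complex.Re R) (zeros Q))].

Lemma zerosE (R : realType) (P : {poly R[i]}) :
  P = lead_coef P *: \prod_(z <- zeros P) ('X - z%:P).
Proof. exact: svalP (closed_field_poly_normal P). Qed.

Lemma hyperbolic0 (R : realType) : hyperbolic R 0 = [set 1].
Proof.
apply/seteqP; split => P /=.
  case=> /monicP lP sP _; have /size_poly1P[c _ PE] : size P == 1%N by rewrite sP.
  by move: lP; rewrite PE lead_coefC => ->.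
move=> ->; split; [exact: monic1 | exact: size_poly1 |].
by move=> z; rewrite (negPf (root1 z)).
Qed.

Lemma size_zeros (R : realType) (n : nat) (P : {poly R[i]}) :
  hyperbolic R n P -> size (zeros P) = n.
Proof.
case=> /monicP lP sP _.
by move: sP; rewrite {1}(zerosE P) lP scale1r size_prod_XsubC => -[].
Qed.

(* Main.v *)
Require Import Defs.
From HB Require Import structures.
From mathcomp Require Import all_boot all_order all_algebra.
From mathcomp Require Import complex polyrcf.
From mathcomp Require Import zify ring.
From mathcomp Require Import classical_sets reals convex interval_inference.

(* Any T in A' commutes with differentiation.  Indeed the zeros y_j of T((X - b)^n)
   satisfy sum_j (y_j - b)^2 = c with c independent of b, hence the polynomial
   T((X - b)^n)(b) in b is bounded, hence constant; equivalently T commutes with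
   translations.

   Let P = prod_i (X - z_i), Q_i = P / (X - z_i), U = T(P) and V_i = T(Q_i).
   As P + c Q_i is hyperbolic for all real c, so is U + c V_i; hence U/V_i takes no
   real value on the open upper half-plane, and V_i/U = sum_w b_i(w) / (X - w) with
   b_i(w) >= 0, w ranging over the distinct zeros of U.  The two leading
   coefficients of V_i give sum_w b_i(w) = 1 and sum_w b_i(w) w = z_i, while
   sum_i V_i = T(P') = U' says that sum_i b_i(w) is the multiplicity of w.  So the
   weights form a doubly stochastic matrix sending the zeros of U to those of P,
   and Jensen's inequality concludes. *)

Set Implicit Arguments.
Unset Strict Implicit.
Unset Printing Implicit Defensive.

Import Order.TTheory GRing.Theory Num.Theory.
Local Open Scope ring_scope.

(** * Jensen's inequality for finite weighted sums *)

Lemma convex_functionP (R : realType) (f : R -> R) :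
  convex_function [set: R^o] f ->
  forall t x y : R, 0 <= t -> t <= 1 ->
    f (t * x + (1 - t) * y) <= t * f x + (1 - t) * f y.
Proof.
move=> cf t x y t0 t1.
by have := cf (Itv01 t0 t1) x y; rewrite !inE; apply.
Qed.

(** Induction on the list: the head is averaged against the mean of the tail. When the tail has
    total weight zero that mean is meaningless, but then all tail weights vanish. *)
Lemma jensen_seq (R : realType) (f : R -> R) (b : R -> R) (s : seq R) :
  convex_function [set: R^o] f -> (forall w, w \in s -> 0 <= b w) ->
  0 < \sum_(w <- s) b w ->
  (\sum_(w <- s) b w) * f ((\sum_(w <- s) b w * w) / \sum_(w <- s) b w)
    <= \sum_(w <- s) b w * f w.
Proof.
move=> /convex_functionP cf; elim: s => [|x s IHs] bge0; first by rewrite big_nil ltxx.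
have bx : 0 <= b x by apply: bge0; rewrite mem_head.
have bs w : w \in s -> 0 <= b w by move=> ws; apply: bge0; rewrite in_cons ws orbT.
rewrite !big_cons.
set S := \sum_(w <- s) b w; set M := \sum_(w <- s) b w * w.
have S0 : 0 <= S by rewrite /S big_seq sumr_ge0.
have [Sgt0 |] := ltP 0 S.
  move=> tot; set t := b x / (b x + S).
  have t0 : 0 <= t by rewrite divr_ge0 // ltW.
  have t1 : t <= 1 by rewrite ler_pdivrMr // mul1r lerDl.
  have tot0 := lt0r_neq0 tot; have S_neq0 := lt0r_neq0 Sgt0.
  have -> : (b x * x + M) / (b x + S) = t * x + (1 - t) * (M / S).
    by rewrite /t; field; rewrite S_neq0.
  have := cf t x (M / S) t0 t1.
  rewrite -(ler_pM2l tot) => /le_trans; apply.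
  have -> : (b x + S) * (t * f x + (1 - t) * f (M / S)) = b x * f x + S * f (M / S).
    by rewrite /t; field; rewrite tot0.
  by rewrite lerD2l IHs.
move=> Sle0; have Seq0 : S = 0 by apply/le_anti; rewrite Sle0 S0.
have bz w : w \in s -> b w = 0.
  move=> ws; apply/le_anti; rewrite bs // andbT -Seq0 /S (big_rem w) //=.
  by rewrite lerDl big_seq sumr_ge0 // => v /mem_rem/bs.
rewrite Seq0 addr0 => bxgt0.
rewrite /M big_seq big1 ?addr0 => [|w /bz ->]; last by rewrite mul0r.
rewrite [\sum_(w <- s) _]big_seq big1 ?addr0 => [|w /bz ->]; last by rewrite mul0r.
by rewrite mulrAC divff ?lt0r_neq0 // mul1r.
Qed.

(** * Products of linear factors, and bounded polynomials *)

Local Notation "\Pi s" := (\prod_(x <- s) ('X - x%:P)) (at level 10, s at level 8).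

(** The factor ['X] shifts the subleading coefficient to index [size s], so that the empty list fits
    in without a truncated predecessor. *)
Lemma mulX_prod_XsubC (R : comNzRingType) (s : seq R) :
  ('X * \Pi s)`_(size s) = - \sum_(x <- s) x.
Proof.
case: s => [|x s]; first by rewrite !big_nil mulr1 coefX oppr0.
by rewrite coefXM -[(size _).-1]/((size (x :: s)).-1) coefPn_prod_XsubC.
Qed.

(** Newton's identity 2 e_2 = p_1^2 - p_2, doubled to avoid a division. *)
Lemma mulX2_prod_XsubC (R : comNzRingType) (s : seq R) :
  ('X^2 * \Pi s)`_(size s) *+ 2 = (\sum_(x <- s) x) ^+ 2 - \sum_(x <- s) x ^+ 2.
Proof.
elim: s => [|y s IHs]; first by rewrite !big_nil mulr1 coefXn mul0rn expr0n subr0.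
rewrite !big_cons mulrCA mulrBl coefB coefXM coefCM /=.
have -> : ('X^2 * \Pi s)`_(size s).+1 = - \sum_(x <- s) x.
  by rewrite expr2 -mulrA coefXM /= mulX_prod_XsubC.
by rewrite mulrnBl IHs; ring.
Qed.

Lemma coef_size_prod_XsubC (R : comNzRingType) (s : seq R) : (\Pi s)`_(size s) = 1.
Proof. by rewrite -[size s]/((size s).+1.-1) -(size_prod_XsubC s id) -lead_coefE lead_coef_prod_XsubC. Qed.

Lemma deriv_prod_XsubC (R : idomainType) (s : seq R) :
  (\Pi s)^`() = \sum_(z <- s) \Pi (rem z s).
Proof.
elim: s => [|x s IHs]; first by rewrite !big_nil derivC.
rewrite !big_cons derivM derivXsubC mul1r /= eqxx; congr (_ + _).
rewrite IHs mulr_sumr big_seq [RHS]big_seq; apply: eq_bigr => z zs.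
have [->|] := eqVneq x z; last by rewrite big_cons.
by rewrite [RHS](perm_big _ (perm_to_rem zs)) big_cons.
Qed.

(** The square of a nonconstant polynomial has positive leading coefficient, hence tends to
    infinity. *)
Lemma bounded_poly_size (R : realFieldType) (p : {poly R}) (K : R) :
  (forall x, p.[x] ^+ 2 <= K) -> (size p <= 1)%N.
Proof.
move=> pK; rewrite leqNgt; apply/negP => sp.
have p0 : p != 0 by rewrite -size_poly_gt0 (leq_trans _ sp).
have lc : 0 < lead_coef (p ^+ 2).
  by rewrite lead_coef_exp exprn_even_gt0 //= lead_coef_eq0.
have sz : (1 < size (p ^+ 2)%R)%N by rewrite expr2 size_mul //; case: (size p) sp => [|[|k]] //= _; rewrite addnS.
have [n /(_ n (lexx _))] := poly_lim_infty (K + 1) lc sz.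
by rewrite horner_exp leNgt; case/negP; rewrite (le_lt_trans (pK n)) // ltrDl.
Qed.

Lemma poly_ext (R : realFieldType) (p q : {poly R}) :
  (forall x, p.[x] = q.[x]) -> p = q.
Proof.
move=> pq; have /size1_polyC d : (size (p - q)%R <= 1)%N.
  by apply: (@bounded_poly_size _ _ 0) => x; rewrite hornerD hornerN pq subrr expr0n.
apply/eqP; rewrite -subr_eq0 d polyC_eq0.
by rewrite -horner_coef0 hornerD hornerN pq subrr.
Qed.

(** * Commutation with differentiation, for maps on real polynomials *)

Section CentredPreservers.
Variables (R : rcfType) (L : {linear {poly R} -> {poly R}}).

(** The real counterpart of [sum_preservers]; [real_part_map_centred] links the two. *)
Definition centred_preserver := forall s : seq R,
  exists s', [/\ size s' = size s, L (\Pi s) = \Pi s' &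
                 \sum_(x <- s') x = \sum_(x <- s) x].

Hypothesis HL : centred_preserver.

Lemma prod_XsubC_nseq n (b : R) : \Pi (nseq n b) = ('X - b%:P) ^+ n.
Proof. by rewrite big_nseq -Monoid.iteropE. Qed.

Lemma sum_nseq n (b : R) : \sum_(x <- nseq n b) x = n%:R * b.
Proof. by rewrite big_nseq iter_addr_0 mulr_natl. Qed.

Lemma preserver_Xn n : exists s',
  [/\ size s' = n, L 'X^n = \Pi s' & \sum_(x <- s') x = 0].
Proof.
have [s' [sz Ls sm]] := HL (nseq n 0).
exists s'; split; first by rewrite sz size_nseq.
- by rewrite -Ls prod_XsubC_nseq subr0.
- by rewrite sm sum_nseq mulr0.
Qed.

Lemma size_preserver n (p : {poly R}) : (size p <= n)%N -> (size (L p) <= n)%N.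
Proof.
move=> sp; rewrite -(coefK p) poly_def raddf_sum.
apply: (leq_trans (size_sum _ _ _)); apply/bigmax_leqP => i _ /=.
rewrite linearZ /= (leq_trans (size_scale_leq _ _)) //.
have [s' [sz -> _]] := preserver_Xn i.
by rewrite size_prod_XsubC sz (leq_trans (ltn_ord i)).
Qed.

Lemma coef_leading n (p : {poly R}) : (size p <= n.+1)%N ->
  exists2 q, p = p`_n *: 'X^n + q & (size q <= n)%N.
Proof.
move=> sp; exists (p - p`_n *: 'X^n); first by rewrite addrC subrK.
apply/leq_sizeP => j nj; rewrite coefB coefZ coefXn.
move: nj; rewrite leq_eqVlt => /predU1P [<-|nj]; first by rewrite eqxx mulr1 subrr.
by rewrite gtn_eqF // mulr0 subr0 nth_default // (leq_trans sp).
Qed.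

Lemma coef_preserver n (p : {poly R}) : (size p <= n.+1)%N -> (L p)`_n = p`_n.
Proof.
move=> /coef_leading [q pE sq]; rewrite pE !linearD !linearZ /= !coefD.
have [s' [sz -> _]] := preserver_Xn n.
rewrite [(L q)`_n]nth_default ?size_preserver // [q`_n]nth_default //.
have e1 : (\Pi s')`_n = 1 by rewrite -sz coef_size_prod_XsubC.
by rewrite !coefZ e1 coefXn eqxx.
Qed.

(** The zeros of [L 'X^n] sum to 0, so its term of degree n - 1 vanishes; the remainder of lower
    degree contributes only its leading coefficient, which [L] keeps. *)
Lemma coefX_preserver n (p : {poly R}) : (size p <= n.+1)%N ->
  ('X * L p)`_n = ('X * p)`_n.
Proof.
move=> /coef_leading [q pE sq]; rewrite pE linearD linearZ /= !mulrDr -!scalerAr !coefD !coefZ.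
have [s' [sz -> sm]] := preserver_Xn n.
have e1 : ('X * \Pi s')`_n = 0 by rewrite -sz mulX_prod_XsubC sm oppr0.
rewrite e1 -exprS coefXn ltn_eqF // !mulr0 !add0r.
rewrite !coefXM; case: (n) sq => [|m] //= sq; exact: coef_preserver.
Qed.

(** Once the leading monomial is split off, the coefficient two below the top is subleading for the
    remainder, hence kept by [L]; only the image of ['X^n] perturbs it. *)
Lemma coefX2_preserver n (p : {poly R}) : (size p <= n.+1)%N ->
  ('X^2 * L p)`_n = ('X^2 * p)`_n + p`_n * ('X^2 * L 'X^n)`_n.
Proof.
move=> /coef_leading [q pE sq].
rewrite {1 2}pE linearD linearZ /= !mulrDr -!scalerAr !coefD !coefZ -exprD.
rewrite [_`_n in RHS]coefXn ltn_eqF ?addnS 1?ltnW // mulr0 add0r addrC; congr (_ + _).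
rewrite expr2 -!mulrA [('X * ('X * L q))`_n]coefXM [('X * ('X * q))`_n]coefXM.
case: (n) sq => [|m] //= sq; exact: coefX_preserver.
Qed.

(* The zeros y of L ((X - b)^n) satisfy \sum_y (y - b)^2 = - 2 a for a
   constant a depending only on n, and their product is the value at b up to sign. *)
Lemma horner_preserver_bounded n : exists K : R,
  forall b : R, (L (('X - b%:P) ^+ n)).[b] ^+ 2 <= K.
Proof.
set a := ('X^2 * L 'X^n)`_n; exists ((- (a *+ 2)) ^+ n) => b.
have [s' [sz Ls sm]] := HL (nseq n b).
have szp : (size (('X - b%:P) ^+ n)%R <= n.+1)%N by rewrite size_exp_XsubC.
(* Both sides are turned into power sums: (n b)^2 - p_2(y) = (n b)^2 - n b^2 + 2 a, where p_2(y) is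
   the sum of the squares of [s']. *)
have := coefX2_preserver szp; rewrite -/a => /(congr1 (fun x => x *+ 2)).
rewrite -prod_XsubC_nseq Ls; rewrite size_nseq in sz.
have nn : size (nseq n b) = n by rewrite size_nseq.
have := mulX2_prod_XsubC s'; rewrite sz sm sum_nseq => ->.
have := mulX2_prod_XsubC (nseq n b); have := coef_size_prod_XsubC (nseq n b).
rewrite nn sum_nseq mulrnDl => -> ->; rewrite mul1r.
have -> : \sum_(x <- nseq n b) x ^+ 2 = n%:R * b ^+ 2.
  by rewrite big_nseq iter_addr_0 mulr_natl.
move=> E.
have sq : \sum_(y <- s') (b - y) ^+ 2 = - (a *+ 2).
  transitivity (\sum_(y <- s') (b ^+ 2 + (y * (- (b *+ 2)) + y ^+ 2))).
    by apply: eq_bigr => y _; ring.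
  rewrite !big_split /= big_const_seq count_predT sz iter_addr_0.
  have -> : \sum_(y <- s') y * (- (b *+ 2)) = n%:R * b * (- (b *+ 2)).
    by rewrite -mulr_suml sm sum_nseq.
  have -> : \sum_(y <- s') y ^+ 2 = n%:R * b ^+ 2 - a *+ 2.
    by apply: (addrI (- (n%:R * b) ^+ 2)); apply: oppr_inj; rewrite opprD opprK E; ring.
  by rewrite -mulr_natl; ring.
(* Each of the n factors (b - y)^2 is one summand of a sum of squares equal to - 2 a, hence at most
   - 2 a. *)
have -> : (- (a *+ 2)) ^+ n = \prod_(y <- s') (- (a *+ 2)).
  by rewrite big_const_seq count_predT sz -Monoid.iteropE.
rewrite horner_prod -prodrXl -sq.
rewrite big_seq [leRHS]big_seq; apply: ler_prod => y ys.
rewrite !hornerE sqr_ge0 /= (big_rem y) //= lerDl.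
by apply: sumr_ge0 => z _; rewrite sqr_ge0.
Qed.

Lemma horner_preserver_const n (b : R) :
  (L (('X - b%:P) ^+ n)).[b] = (L 'X^n).[0].
Proof.
(* Binomial expansion shows that the value at b is a polynomial [g] in b; being bounded, [g] is
   constant. *)
pose g := \sum_(i < n.+1) ((-1) ^+ i *: (L 'X^(n - i) * 'X^i)) *+ 'C(n, i).
have gE (c : R) : g.[c] = (L (('X - c%:P) ^+ n)).[c].
  rewrite exprBn raddf_sum !horner_sum; apply: eq_bigr => i _ /=.
  rewrite raddfMn !hornerMn /=; congr (_ *+ _).
  have -> : (-1) ^+ i * 'X^(n - i) * c%:P ^+ i = ((-1) ^+ i * c ^+ i : R) *: ('X^(n - i) : {poly R}).
    by rewrite -polyC_exp -mulrA mulrCA mulrA -mul_polyC !polyCM !polyC_exp polyCN; ring.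
  by rewrite linearZ /= !hornerE /= mulrAC.
have [K bK] := horner_preserver_bounded n.
have /size1_polyC gC : (size g <= 1)%N.
  by apply: (@bounded_poly_size _ _ K) => x; rewrite gE.
rewrite -gE -[L 'X^n]/(L ('X^n)).
have -> : 'X^n = ('X - 0%:P) ^+ n :> {poly R} by rewrite subr0.
by rewrite -gE gC !hornerC.
Qed.

(** Expand X^n = ((X - b) + b)^n and evaluate the image at b: by [horner_preserver_const] the values
    that appear do not depend on b. The images of the monomials thus form an Appell sequence. *)
Lemma preserver_XnE n : L 'X^n = \poly_(i < n.+1) ((L 'X^(n - i)).[0] *+ 'C(n, i)).
Proof.
apply: poly_ext => b.
rewrite -{1}['X](subrK b%:P) exprDn raddf_sum horner_sum horner_poly.
apply: eq_bigr => i _ /=.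
rewrite raddfMn hornerMn mulrnAl /=; congr (_ *+ _).
by rewrite mulrC -polyC_exp mul_polyC linearZ /= hornerZ horner_preserver_const mulrC.
Qed.

Lemma preserver_deriv p : L p^`() = (L p)^`().
Proof.
have H n : L ('X^n)^`() = (L 'X^n)^`().
  apply/polyP => i; rewrite derivXn coef_deriv; case: n => [|n].
    by rewrite mulr0n raddf0 coef0 (preserver_XnE 0) coef_poly /= mul0rn.
  rewrite raddfMn coefMn /= !preserver_XnE /= !coef_poly subSS !ltnS.
  case: ifP => _; last by rewrite !mul0rn.
  (* The identity (n + 1) C(n, i) = (i + 1) C(n + 1, i + 1). *)
  by rewrite -!mulrnA mulnC (mulnC _ i.+1) -mul_bin_diag. 
rewrite -(coefK p) poly_def !raddf_sum /=; apply: eq_bigr => i _ /=.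
by rewrite !linearZ /= H.
Qed.

End CentredPreservers.

(** * Imaginary parts along rays in the upper half-plane *)

Section Interlacing.
Variable R : rcfType.
Local Open Scope complex_scope.
Local Notation toC := (real_complex R).

Lemma ImM_real (r : R) (z : R[i]) : complex.Im (r%:C * z) = r * complex.Im z.
Proof. by case: z => a b /=; rewrite mul0r addr0. Qed.

Lemma map_poly_ImE (q : {poly R[i]}) (s : R) :
  (map_poly (@complex.Im R) q).[s] = complex.Im q.[s%:C].
Proof.
rewrite (@horner_coef_wide _ (size q)) ?size_poly // horner_coef.
rewrite (raddf_sum (@complex.Im R : Rcomplex R -> R)) /=; apply: eq_bigr => i _.
rewrite coef_map_id0 // -rmorphXn /= mulrC -ImM_real mulrC.
by case: (q`_i) => a b.
Qed.

Lemma Im_normM (z : R[i]) k : 0 < complex.Im z ->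
  0 < complex.Im (z * (z * conjc z) ^+ k).
Proof.
move=> z0; have -> : z * conjc z = (complex.Re z ^+ 2 + complex.Im z ^+ 2)%:C.
  by case: (z) => a b; apply/eqP; rewrite eq_complex /=; apply/andP; split; apply/eqP; ring.
rewrite -rmorphXn mulrC ImM_real mulr_gt0 // exprn_gt0 //.
by rewrite ltr_wpDl ?sqr_ge0 // exprn_gt0.
Qed.

(* On the ray w + s z, s > 0, the imaginary part in the hypothesis is a nonvanishing
   polynomial in s, positive for large s; the conclusion is the sign at s = 0 of this
   polynomial divided by s ^ l. *)
Lemma ray_ge0 (u v : {poly R}) (w : R) (l : nat) (z : R[i]) :
  u \is monic -> v \is monic -> (size u + l = (size v).+1)%N ->
  (forall x : R[i], 0 < complex.Im x ->
     complex.Im ((x - w%:C) ^+ l * (map_poly toC u).[x] * conjc (map_poly toC v).[x])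
       != 0) ->
  0 < complex.Im z -> 0 <= complex.Im (z ^+ l) * (u.[w] * v.[w]).
Proof.
move=> mu mv szE nz z0.
have zn0 : z != 0 by apply: contraTneq z0 => ->; rewrite ltxx.
pose lin : {poly R[i]} := z *: 'X + (w%:C)%:P.
have linE s : lin.[s] = z * s + w%:C by rewrite !hornerE.
have [szl lcl] : size lin = 2%N /\ lead_coef lin = z.
  have sz : (size (w%:C)%:P < size (z *: 'X : {poly R[i]}))%N.
    by rewrite size_scale // size_polyX ltnS size_polyC leq_b1.
  by rewrite /lin size_polyDl // lead_coefDl // size_scale // size_polyX lead_coefZ lead_coefX mulr1.
(* Conjugating the coefficients of v along the ray agrees with conjugating its values at real s, so
   that [q] is a genuine polynomial in s. *)
pose q : {poly R[i]} := z ^+ l *: ((map_poly toC u \Po lin) *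
                     map_poly conjc (map_poly toC v \Po lin)).
have qE (s : R) : q.[s%:C] = z ^+ l * (map_poly toC u).[z * s%:C + w%:C] *
    conjc (map_poly toC v).[z * s%:C + w%:C].
  rewrite hornerZ hornerM -{2}(conjc_real s) horner_map !horner_comp linE mulrA.
  by [].
(* Since deg u + l = deg v + 1, there is exactly one more factor z than conjugates of z. *)
have lcq : lead_coef q = z * (z * conjc z) ^+ (size v).-1.
  rewrite lead_coefZ lead_coefM lead_coef_map !lead_coef_comp ?szl //.
  rewrite !lead_coef_map !size_map_poly lcl (monicP mu) (monicP mv) !rmorph1 !mul1r.
  rewrite /= rmorphXn exprMn mulrA -exprD mulrA -exprS; congr (_ ^+ _ * _).
  have : (0 < size u)%N by rewrite size_poly_gt0 monic_neq0.
  have : (0 < size v)%N by rewrite size_poly_gt0 monic_neq0.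
  move: szE; case: (size v) => // b; case: (size u) => // a; rewrite addSn => -[<-] _ _; exact: addnC.
pose k := map_poly (@complex.Im R) q.
have lck : 0 < lead_coef k.
  by rewrite lead_coef_map_id0 //= lcq ?lt0r_neq0 // Im_normM.
have k0 : k.[0] = complex.Im (z ^+ l) * (u.[w] * v.[w]).
  rewrite map_poly_ImE qE mulr0 add0r !horner_map /= oppr0 -mulrA mulrC -rmorphM.
  by rewrite ImM_real mulrC.
rewrite -k0 leNgt; apply/negP => klt0.
have [n kn] := poly_pinfty_gt_lc lck.
have b0 : 0 <= Num.max 0 n by rewrite le_max lexx.
have kb : 0 <= k.[Num.max 0 n].
  by rewrite (le_trans (ltW lck)) // kn // le_max lexx orbT.
have [s /andP [s0 _] /rootP ks] := @poly_ivt _ k 0 _ b0 (introT andP (conj (ltW klt0) kb)).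
have sgt0 : 0 < s.
  by rewrite lt_neqAle s0 andbT eq_sym; apply: contraTneq klt0 => E; move: ks; rewrite E => ->; rewrite ltxx.
have Im_pos : 0 < complex.Im (z * s%:C + w%:C).
  by rewrite raddfD /= addr0 mulrC ImM_real mulr_gt0.
have /eqP := nz _ Im_pos; apply.
rewrite addrK exprMn -rmorphXn -!mulrA mulrCA ImM_real mulrA -qE -map_poly_ImE.
by rewrite -/k ks mulr0.
Qed.

(* The l-th roots of a i are nonreal and sum to zero. *)
Lemma power_root_Im_gt0 (l : nat) (a : R) : (1 < l)%N -> a != 0 ->
  exists2 z : R[i], 0 < complex.Im z & complex.Im (z ^+ l) = a.
Proof.
move=> l1 a0; have l0 : (0 < l)%N by apply: ltnW.
pose p : {poly R[i]} := 'X^l - (0 +i* a)%:P.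
have [rs pE] := closed_field_poly_normal p.
have lcp : lead_coef p = 1 by rewrite lead_coefXnsubC.
have szrs : size rs = l.
  have := congr1 (fun p : {poly R[i]} => size p) pE.
  by rewrite lcp scale1r size_prod_XsubC size_XnsubC // => -[].
have sum0 : \sum_(r <- rs) r = 0.
  have E : p = \Pi rs by rewrite {1}pE lcp scale1r.
  apply: oppr_inj; rewrite -coefPn_prod_XsubC ?szrs -?lt0n // -E.
  rewrite oppr0 coefB coefXn coefC.
  by case: (l) l1 => [|[|m]] //= _; rewrite ltn_eqF // subr0.
have rootE r : r \in rs -> r ^+ l = 0 +i* a.
  move=> rrs; have : root p r by rewrite pE lcp scale1r root_prod_XsubC.
  by rewrite /root !hornerE subr_eq0 => /eqP.
have [/hasP [r rrs Ir]|/hasPn nI] := boolP (has (fun r : R[i] => 0 < complex.Im r) rs).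
  by exists r => //; rewrite rootE.
have Ile r : r \in rs -> complex.Im r <= 0 by move=> /nI; rewrite leNgt.
case: rs pE szrs sum0 rootE nI Ile => [|r rs] _; first by move=> /= E; rewrite -E in l0.
move=> _ sum0 rootE _ Ile.
(* Nonpositive imaginary parts with sum 0 all vanish; but a real r would make [r ^+ l] real. *)
have rIm : complex.Im r = 0.
  apply/le_anti; rewrite Ile ?mem_head //=.
  move: sum0 => /(congr1 (@complex.Im R)).
  rewrite (raddf_sum (@complex.Im R : Rcomplex R -> R)) /= big_cons => /eqP.
  rewrite addr_eq0 => /eqP ->; rewrite oppr_ge0 big_seq.
  by apply: sumr_le0 => x xs; rewrite Ile // in_cons xs orbT.
have := rootE r (mem_head _ _).
have -> : r = (complex.Re r)%:C by case: (r) rIm => x y /= ->.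
by rewrite -rmorphXn => -[_ E]; move: a0; rewrite -E eqxx.
Qed.

End Interlacing.

(** * Simple poles, nonnegative residues and partial fractions *)

Section Weights.
Variable R : rcfType.
Local Open Scope complex_scope.
Local Notation toC := (real_complex R).
Implicit Types (s ys vs : seq R) (V : {poly R}).

Lemma prod_XsubC_split s (w : R) :
  \Pi s = ('X - w%:P) ^+ count_mem w s * \Pi [seq y <- s | y != w].
Proof.
rewrite (bigID (pred1 w)) /= big_filter; congr (_ * _).
rewrite (eq_bigr (fun _ => 'X - w%:P)) => [|y /eqP ->] //.
by rewrite big_const_seq -Monoid.iteropE.
Qed.

Lemma horner_filter_neq0 s (w : R) : (\Pi [seq y <- s | y != w]).[w] != 0.
Proof. by rewrite -/(root _ _) root_prod_XsubC mem_filter eqxx. Qed.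

Lemma size_filter_neq s (w : R) :
  (size [seq y <- s | y != w] + count_mem w s = size s)%N.
Proof. by rewrite size_filter addnC count_predC. Qed.

Lemma prod_XsubC_nonreal s (x : R[i]) : 0 < complex.Im x ->
  (map_poly toC (\Pi s)).[x] != 0.
Proof.
move=> x0; rewrite -/(root _ _) map_prod_XsubC -(big_map toC xpredT (fun y => 'X - y%:P)).
rewrite root_prod_XsubC.
by apply: contraTN x0 => /mapP [y _ ->]; rewrite ltxx.
Qed.

(** As every member of the pencil splits over the reals, the quotient of the two products takes no
    real value in the upper half-plane. Near a zero of order l of this quotient, Im (z^l) must then
    keep one sign there, which forces l = 1 and fixes the sign of the residue. *)
Lemma pencil_zeros ys vs (w : R) : size ys = (size vs).+1 -> w \in ys ->
  (forall c : R, exists s, \Pi ys + c *: \Pi vs = \Pi s) ->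
  exists2 v, \Pi vs = ('X - w%:P) ^+ (count_mem w ys).-1 * v &
             0 <= v.[w] / (\Pi [seq y <- ys | y != w]).[w].
Proof.
move=> sz wys pencil.
have m0 : (0 < count_mem w ys)%N by rewrite -has_count has_pred1.
set m := count_mem w ys in m0 *; set k := count_mem w vs.
set U := \Pi [seq y <- ys | y != w]; set V := \Pi [seq y <- vs | y != w].
have UE : \Pi ys = ('X - w%:P) ^+ m * U by exact: prod_XsubC_split.
have VE : \Pi vs = ('X - w%:P) ^+ k * V by exact: prod_XsubC_split.
have Uw : U.[w] != 0 by exact: horner_filter_neq0.
have Vw : V.[w] != 0 by exact: horner_filter_neq0.
(* If m <= k there is no pole at w: [v] keeps a factor ['X - w%:P] and vanishes there. *)
have [mk|km] := leqP m k.
  exists (('X - w%:P) ^+ (k - m.-1) * V); first by rewrite mulrA -exprD subnKC // ltnW // prednK.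
  by rewrite hornerM horner_exp hornerXsubC subrr expr0n subn_eq0 leqNgt prednK // mk !mul0r.
have szUV : (size U + (m - k) = (size V).+1)%N.
  have := size_filter_neq ys w; have := size_filter_neq vs w.
  rewrite -/m -/k sz !size_prod_XsubC => <-.
  by move: km; lia.
have nonreal (x : R[i]) : 0 < complex.Im x ->
    complex.Im ((x - w%:C) ^+ (m - k) * (map_poly toC U).[x] * conjc (map_poly toC V).[x]) != 0.
  move=> x0; have xw : x - w%:C != 0.
    by apply: contraTneq x0 => /subr0_eq ->; rewrite ltxx.
  have Vx : (map_poly toC V).[x] != 0 by exact: prod_XsubC_nonreal.
  set a := (x - w%:C) ^+ (m - k) * (map_poly toC U).[x].
  set b := (map_poly toC V).[x] in Vx *.
  apply/eqP => Im0.
  have [r rE] : exists r : R, a * conjc b = r%:C.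
    by exists (complex.Re (a * conjc b)); move: Im0; case: (a * conjc b) => p q /= ->.
  have [t tE] : exists t : R, b * conjc b = t%:C.
    exists (complex.Re b ^+ 2 + complex.Im b ^+ 2); case: (b) => p q.
    by apply/eqP; rewrite eq_complex /=; apply/andP; split; apply/eqP; ring.
  have t0 : t%:C != 0 by rewrite -tE mulf_neq0 // conjc_eq0.
  (* The quotient of the two products at x is a / b = r / t, a real number, so this member of the
     pencil vanishes at the nonreal x. *)
  have [s sE] := pencil (- (r / t)).
  have fac j (p : {poly R}) : (map_poly toC (('X - w%:P) ^+ j * p)).[x] =
      (x - w%:C) ^+ j * (map_poly toC p).[x].
    by rewrite rmorphM rmorphXn /= map_polyXsubC !hornerE.
  have aE : a = (r / t)%:C * b.
    apply: (mulIf (_ : conjc b != 0)); first by rewrite conjc_eq0.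
    by rewrite rE -mulrA tE -rmorphM divfK // -(inj_eq (@complexI R)).
  have /eqP := prod_XsubC_nonreal s x0; apply.
  rewrite -sE UE VE rmorphD /= map_polyZ hornerD hornerZ !fac -/b.
  rewrite -{1}(subnKC (ltnW km)) exprD -mulrA -/a aE rmorphN /=.
  by rewrite mulrCA mulNr subrr.
have ray z := ray_ge0 (monic_prod_XsubC _ _ _) (monic_prod_XsubC _ _ _) szUV nonreal (z := z).
(* For an exponent above 1, Im (z^l) can be made equal to - U(w) V(w), and [ray] would declare minus
   a nonzero square nonnegative. *)
have mk1 : (m - k)%N = 1%N.
  apply/eqP; rewrite eqn_leq subn_gt0 km andbT leqNgt; apply/negP => l1.
  have UV0 : - (U.[w] * V.[w]) != 0 by rewrite oppr_eq0 mulf_neq0.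
  have [z z0 zE] := power_root_Im_gt0 l1 UV0.
  have := ray z z0; rewrite zE mulNr oppr_ge0 -expr2 leNgt.
  by rewrite exprn_even_gt0 //= -oppr_eq0 UV0.
exists V; first by rewrite VE; congr (_ ^+ _ * _); rewrite -subn1 -mk1 subKn // ltnW.
have := ray 'i; rewrite mk1 expr1 /= mul1r => /(_ ltr01) UV.
have -> : V.[w] / U.[w] = U.[w] * V.[w] * U.[w]^-1 ^+ 2 by field.
by rewrite mulr_ge0 // sqr_ge0.
Qed.

Lemma prod_XsubC_dvdp s (p : {poly R}) :
  (forall w, w \in s -> ('X - w%:P) ^+ count_mem w s %| p) -> \Pi s %| p.
Proof.
have [->|p0] := eqVneq p 0; first by rewrite dvdp0.
elim: s p p0 => [|y s IHs] p p0 dvd; first by rewrite big_nil dvd1p.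
have /dvdpP [q qE] : 'X - y%:P %| p.
  apply: dvdp_trans (dvd y (mem_head _ _)); rewrite /= eqxx exprS; exact: dvdp_mulr.
have q0 : q != 0 by apply: contraNneq p0 => E; rewrite qE E mul0r.
rewrite big_cons qE mulrC dvdp_mul2r ?polyXsubC_eq0 //; apply: IHs => // w ws.
have := dvd w; rewrite in_cons ws orbT => /(_ isT).
rewrite -!mup_geq // qE mupM ?polyXsubC_eq0 //= addnC.
by rewrite -['X - y%:P]expr1 mup_XsubCX; case: eqP => _; rewrite ?addn1 ?addn0 ?add1n ?add0n.
Qed.

(* The residue of V / \Pi ys at w, provided that pole is simple. *)
Definition weight ys V (w : R) :=
  (V %/ ('X - w%:P) ^+ (count_mem w ys).-1).[w] / (\Pi [seq y <- ys | y != w]).[w].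

Lemma weightE ys (w : R) p : weight ys (('X - w%:P) ^+ (count_mem w ys).-1 * p) w =
  p.[w] / (\Pi [seq y <- ys | y != w]).[w].
Proof. by rewrite /weight mulKp // expf_neq0 // polyXsubC_eq0. Qed.

Lemma prod_rem ys (w : R) : w \in ys -> \Pi (rem w ys) =
  ('X - w%:P) ^+ (count_mem w ys).-1 * \Pi [seq y <- ys | y != w].
Proof.
move=> wys; apply: (mulfI (_ : 'X - w%:P != 0)); first by rewrite polyXsubC_eq0.
rewrite mulrA -exprS prednK; last by rewrite -has_count has_pred1.
by rewrite -prod_XsubC_split (perm_big _ (perm_to_rem wys)) big_cons.
Qed.

(** The difference of the two sides has degree below that of [\Pi ys], yet is divisible by it: at w,
    the weight cancels the residue of V, and the terms of the other zeros already contain w to full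
    multiplicity. *)
Lemma partial_fractions ys V : (size V <= size ys)%N ->
  (forall w, w \in ys -> ('X - w%:P) ^+ (count_mem w ys).-1 %| V) ->
  V = \sum_(w <- undup ys) weight ys V w *: \Pi (rem w ys).
Proof.
move=> sV dV; apply/eqP; rewrite -subr_eq0; set S := \sum_(w <- _) _.
have sE : (size (V - S)%R <= size ys)%N.
  rewrite (leq_trans (size_polyD _ _)) // geq_max sV size_polyN.
  apply: (leq_trans (size_sum _ _ _)); apply/bigmax_leqP_seq => w + _.
  rewrite mem_undup => wys; rewrite (leq_trans (size_scale_leq _ _)) //.
  by rewrite size_prod_XsubC size_rem // prednK //; case: (ys) wys.
suff /dvdp_leq E : \Pi ys %| V - S.
  by apply: contraLR sE => /E; rewrite size_prod_XsubC -ltnNge.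
apply: prod_XsubC_dvdp => w wys.
have m0 : (0 < count_mem w ys)%N by rewrite -has_count has_pred1.
rewrite /S (bigD1_seq w) ?mem_undup ?undup_uniq //= opprD addrA dvdp_sub //.
  have /dvdpP [v vE] := dV w wys.
  rewrite mulrC in vE; rewrite vE prod_rem // weightE scalerAr -mulrBr.
  rewrite -{1}(prednK m0) exprSr dvdp_mul2l ?expf_neq0 ?polyXsubC_eq0 //.
  rewrite dvdp_XsubCl /root !hornerE divfK ?subrr //; exact: horner_filter_neq0.
rewrite big_seq_cond; apply: (big_ind (fun p => _ %| p)); first exact: dvdp0.
  by move=> p q; exact: dvdp_add.
move=> y /andP []; rewrite mem_undup => yys yw.
rewrite -mul_polyC; apply: dvdp_mull; rewrite prod_rem //; apply: dvdp_mull.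
have -> : count_mem w ys = count_mem w [seq x <- ys | x != y].
  rewrite count_filter; apply: eq_count => x /=.
  by case: eqVneq => // ->; rewrite eq_sym yw.
by rewrite (prod_XsubC_split _ w) dvdp_mulr.
Qed.

Lemma weight_sum ys (I : Type) (r : seq I) (F : I -> {poly R}) w :
  weight ys (\sum_(i <- r) F i) w = \sum_(i <- r) weight ys (F i) w.
Proof.
rewrite /weight -mulr_suml -horner_sum; congr (_.[_] / _).
elim: r => [|i r IHr]; first by rewrite !big_nil div0p.
by rewrite !big_cons divpD IHr.
Qed.

(** The residue of a logarithmic derivative is the multiplicity. *)
Lemma weight_deriv ys w : w \in ys ->
  weight ys (\Pi ys)^`() w = (count_mem w ys)%:R.
Proof.
move=> wys; have m0 : (0 < count_mem w ys)%N by rewrite -has_count has_pred1.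
rewrite {1}(prod_XsubC_split ys w) derivM deriv_exp derivXsubC mul1r.
set U := \Pi [seq _ <- _ | _].
have -> : ('X - w%:P) ^+ (count_mem w ys).-1 *+ count_mem w ys * U +
    ('X - w%:P) ^+ count_mem w ys * U^`() =
    ('X - w%:P) ^+ (count_mem w ys).-1 * (U *+ count_mem w ys + ('X - w%:P) * U^`()).
  by rewrite mulrDr mulrnAl mulrnAr mulrA -exprSr prednK.
rewrite weightE !hornerE subrr mul0r addr0 hornerMn -/U.
by rewrite mulrnAl divff // horner_filter_neq0.
Qed.

End Weights.

(** * Majorization for real zero lists *)

Section Majorization.
Variables (R : realType) (L : {linear {poly R} -> {poly R}}).
Hypothesis HL : centred_preserver L.

(** The weights attached to z form a probability measure with mean z on the distinct zeros of the
    image. *)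
Lemma preserver_jensen (zs ys : seq R) (z : R) (f : R -> R) :
  L (\Pi zs) = \Pi ys -> convex_function [set: R^o] f -> z \in zs ->
  f z <= \sum_(w <- undup ys) weight ys (L (\Pi (rem z zs))) w * f w.
Proof.
move=> Lzs cf zin; set V := L _.
have prod_inj (s s' : seq R) : \Pi s = \Pi s' -> size s = size s'.
  by move=> /(congr1 (fun p : {poly R} => size p)); rewrite !size_prod_XsubC => -[].
have [ys' [szys Lys sumys]] := HL zs; rewrite Lzs in Lys.
have szE : size ys = size zs by rewrite (prod_inj _ _ Lys).
have sumE : \sum_(y <- ys) y = \sum_(y <- zs) y.
  rewrite -sumys; apply: oppr_inj; rewrite -!mulX_prod_XsubC szE szys.
  by rewrite Lys.
have [vs [szvs VE sumvs]] := HL (rem z zs); rewrite -/V in VE.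
have szr : size zs = (size vs).+1.
  by rewrite szvs size_rem // prednK //; case: (zs) zin.
have pencil (c : R) : exists s, \Pi ys + c *: \Pi vs = \Pi s.
  (* Adding c times the cofactor of X - z moves the zero z to z - c. *)
  have [s [_ sE _]] := HL (z - c :: rem z zs).
  exists s; rewrite -sE -VE -Lzs -linearZ -linearD /= (perm_big _ (perm_to_rem zin)) !big_cons.
  by congr (L _); rewrite -mul_polyC -mulrDl polyCB opprB addrA addrAC.
have szyv : size ys = (size vs).+1 by rewrite szE.
have dV w : w \in ys -> ('X - w%:P) ^+ (count_mem w ys).-1 %| V.
  by move=> wys; have [v vE _] := pencil_zeros szyv wys pencil; rewrite VE vE dvdp_mulr.
have b0 w : w \in undup ys -> 0 <= weight ys V w.
  rewrite mem_undup => wys; have [v vE v0] := pencil_zeros szyv wys pencil.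
  by rewrite VE vE weightE.
have sV : (size V <= size ys)%N by rewrite VE size_prod_XsubC szyv.
have VS := partial_fractions sV dV.
have szrem w : w \in ys -> size (rem w ys) = size vs by move=> ?; rewrite size_rem // szyv.
(* Leading coefficients in the partial fraction expansion. *)
have b1 : \sum_(w <- undup ys) weight ys V w = 1.
  rewrite -(coef_size_prod_XsubC vs) -VE {2}VS coef_sum big_seq [RHS]big_seq.
  apply: eq_bigr => w; rewrite mem_undup => wys.
  by rewrite coefZ -(szrem w wys) coef_size_prod_XsubC mulr1.
have bz : \sum_(w <- undup ys) weight ys V w * w = z.
  have sumrem w : w \in ys -> \sum_(y <- rem w ys) y = \sum_(y <- ys) y - w.
    by move=> wys; rewrite [X in X - w](big_rem w) //= [w + _]addrC addrK.
  (* Subleading coefficients: omitting z on one side and w on the other lowers zero sums that are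
     equal. *)
  have : ('X * V)`_(size vs) = - (\sum_(y <- zs) y - z).
    rewrite VE mulX_prod_XsubC sumvs; congr (- _).
    by rewrite [X in X - z](big_rem z) //= [z + _]addrC addrK.
  rewrite {1}VS mulr_sumr coef_sum.
  have -> : \sum_(w <- undup ys) ('X * (weight ys V w *: \Pi (rem w ys)))`_(size vs)
      = \sum_(w <- undup ys) (weight ys V w * w - weight ys V w * \sum_(y <- ys) y).
    rewrite big_seq [RHS]big_seq; apply: eq_bigr => w; rewrite mem_undup => wys.
    rewrite -scalerAr coefZ -(szrem w wys) mulX_prod_XsubC sumrem //.
    by rewrite opprB mulrBr.
  by rewrite sumrB -mulr_suml b1 mul1r sumE opprB => /addIr.
have := jensen_seq cf b0; rewrite b1 bz divr1 mul1r; apply; exact: ltr01.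
Qed.

Theorem preserver_majorized (zs ys : seq R) :
  L (\Pi zs) = \Pi ys -> majorized zs ys.
Proof.
move=> Lzs; split.
  have [ys' [szys + _]] := HL zs; rewrite Lzs -szys.
  by move=> /(congr1 (fun p : {poly R} => size p)); rewrite !size_prod_XsubC => -[].
move=> f cf.
have -> : \sum_(y <- ys) f y = \sum_(w <- undup ys) (count_mem w ys)%:R * f w.
  rewrite -big_undup_iterop_count; apply: eq_bigr => w _.
  by rewrite Monoid.iteropE iter_addr_0 mulr_natl.
have -> : \sum_(w <- undup ys) (count_mem w ys)%:R * f w =
    \sum_(z <- zs) \sum_(w <- undup ys) weight ys (L (\Pi (rem z zs))) w * f w.
  (* The weights at w, summed over z, are the residue of U' / U at w, because [L] commutes with
     differentiation. *)
  rewrite exchange_big /= big_seq [RHS]big_seq; apply: eq_bigr => w.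
  rewrite mem_undup => wys; rewrite -mulr_suml -weight_sum; congr (_ * _).
  rewrite -(weight_deriv wys) -Lzs -(preserver_deriv HL) deriv_prod_XsubC.
  by rewrite raddf_sum.
rewrite big_seq [leRHS]big_seq; apply: ler_sum => z zin.
exact: preserver_jensen.
Qed.

End Majorization.

(** * Passage from complex to real polynomials *)

Section RealPart.
Variable R : realType.
Local Notation toC := (real_complex R).
Local Notation zeros_Re P := (map (@complex.Re R) (zeros P)).

Lemma hyperbolic_prod n (P : {poly R[i]}) : hyperbolic R n P ->
  P = map_poly toC (\Pi (zeros_Re P)).
Proof.
case=> /monicP lcP _ real; rewrite {1}(zerosE P) lcP scale1r map_prod_XsubC big_map.
rewrite big_seq [RHS]big_seq; apply: eq_bigr => z zP; congr ('X - _%:P).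
by rewrite /= RRe_real // real // (zerosE P) lcP scale1r root_prod_XsubC.
Qed.

Lemma prod_hyperbolic (s : seq R) : hyperbolic R (size s) (map_poly toC (\Pi s)).
Proof.
split; first by rewrite map_monic monic_prod_XsubC.
  by rewrite size_map_poly size_prod_XsubC.
move=> z; rewrite map_prod_XsubC -(big_map toC xpredT (fun y => 'X - y%:P)).
rewrite root_prod_XsubC => /mapP [x _ ->]; by apply/complex_realP; exists x.
Qed.

Lemma sum_zeros_hyperbolic n (P : {poly R[i]}) : hyperbolic R n P ->
  sum_zeros P = toC (\sum_(x <- zeros_Re P) x).
Proof.
move=> [/monicP lcP _ real]; rewrite /sum_zeros rmorph_sum big_map /=.
rewrite big_seq [RHS]big_seq; apply: eq_bigr => z zP.
by rewrite RRe_real // real // (zerosE P) lcP scale1r root_prod_XsubC.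
Qed.

(** If T preserves hyperbolicity, the image of a product of real linear factors is already real, and
    taking real parts loses nothing there. *)
Definition real_part_map (T : {linear {poly R[i]} -> {poly R[i]}}) (p : {poly R}) :
  {poly R} := map_poly (@complex.Re R) (T (map_poly toC p)).

Lemma real_part_map_linear T : linear (real_part_map T).
Proof.
move=> a p q; rewrite /real_part_map rmorphD /= map_polyZ /= linearP.
apply/polyP => i; rewrite coefD coefZ !coef_map_id0 // coefD coefZ.
by case: (_`_i) => x y; case: (_`_i) => x' y' /=; rewrite mul0r subr0.
Qed.

HB.instance Definition _ T := GRing.isLinear.Build R {poly R} {poly R} _
  (real_part_map T) (real_part_map_linear T).

Lemma map_polyReK : cancel (map_poly toC) (map_poly (@complex.Re R)).
Proof. by move=> p; apply/polyP => i; rewrite !coef_map_id0. Qed.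

Lemma real_part_map_centred T : sum_preservers R T ->
  centred_preserver (real_part_map T).
Proof.
move=> [hT sT] s; set P := map_poly toC (\Pi s).
have hP : hyperbolic R (size s) P by exact: prod_hyperbolic.
have hTP : hyperbolic R (size s) (T P) by apply: (hT (size s) I); exists P.
exists (zeros_Re (T P)); split; first by rewrite size_map (size_zeros hTP).
  by have := congr1 (map_poly (@complex.Re R)) (hyperbolic_prod hTP); rewrite map_polyReK.
(* The condition on zero sums concerns nonconstant polynomials only; for empty [s] both lists are
   empty. *)
have := size_zeros hTP; case: (posnP (size s)) => [s0|s0 _].
  rewrite s0 => /size0nil ->; move/size0nil: s0 => ->.
  by rewrite !big_nil.
have sP : sum_zeros P = toC (\sum_(x <- s) x).
  rewrite (sum_zeros_hyperbolic hP); congr (toC _).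
  have zP : size (zeros_Re P) = size s by rewrite size_map (size_zeros hP).
  (* [zeros P] may list the entries of [s] in another order, so the sums are compared through the
     subleading coefficient. *)
  apply: oppr_inj; rewrite -!mulX_prod_XsubC zP.
  have /(congr1 (map_poly (@complex.Re R))) := hyperbolic_prod hP.
  by rewrite !map_polyReK => <-.
apply: (@complexI R).
rewrite -(sum_zeros_hyperbolic hTP) sT ?sP //.
by case: hP => _ ->.
Qed.

End RealPart.

Unset Implicit Arguments.

Theorem theorem6 (R : realType) (n : nat) (hn : (1 <= n)%N)
    (P : {poly R[i]}) (hP : hyperbolic R n P)
    (T : {linear {poly R[i]} -> {poly R[i]}}) (hT : sum_preservers R T) :
  zeros_majorized n P (T P).
Proof.
have hTP : hyperbolic R n (T P) by apply: (hT.1 n I); exists P.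
split=> //; apply: (preserver_majorized (real_part_map_centred hT)).
rewrite /= /real_part_map -(hyperbolic_prod hP).
by have := congr1 (map_poly (@complex.Re R)) (hyperbolic_prod hTP); rewrite map_polyReK.
Qed.
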